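(* Let $a\ge2$ and $0\le b<a$ be integers, and run the golden sieve on $W_0=a\mathbb{N}+b$. Then the normalized survivor gaps satisfy $$\sigma_n-\sigma_{n-1}\in\{1,2\}\qquad(n\ge2).$$
   Context: $\mathbb{N}=\{1,2,3,\ldots\}$ and $a\mathbb{N}+b=\{an+b:n\ge1\}$, viewed as an increasing sequence. For a strictly increasing sequence $X$ of positive integers, $X(k)$ denotes its $k$-th term. Golden sieve: let $W_0=(w_1<w_2<\cdots)$ be an infinite strictly increasing sequence of positive integers. For $n\ge1$ define inductively $h_n:=W_{n-1}(n)$ (the pointer), $d_n:=W_{n-1}(h_n)$ (the deletion), and let $W_n$ be the increasing sequence obtained from $W_{n-1}$ by removing the value $d_n$. The survivor sequence $(s_n)_{n\ge1}$ is the increasing enumeration of $W_0\setminus\{d_1,d_2,\ldots\}$. Normalized survivors for $W_0=a\mathbb{N}+b$: $\sigma_n:=(s_n-b)/a$. *)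

(* Defs.v *)
From HB Require Import structures.
From mathcomp Require Import all_boot all_order all_algebra.
From mathcomp Require Import boolp classical_sets.

Set Implicit Arguments.
Unset Strict Implicit.
Unset Printing Implicit Defensive.

Import Order.TTheory GRing.Theory Num.Theory.

Local Open Scope classical_set_scope.
Local Open Scope nat_scope.

(* A sequence of positive integers is a function X : nat -> nat whose k-th term
   is X k for k >= 1; the value X 0 is not a term. *)
Definition terms (X : nat -> nat) : set nat := [set X k | k in [set k | 1 <= k]].

(* The default 0 is returned only when A is empty. *)
Definition least (A : set nat) : nat :=
  xget 0 [set m | A m /\ forall k, A k -> m <= k].

(* The k-th smallest element (k >= 1) of a set A of positive integers. If A has
   fewer than k elements this is junk, and the sequence is not increasing. *)
Fixpoint increasing_enum (A : set nat) (k : nat) : nat :=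
  if k is k'.+1 then least (A `&` [set m | increasing_enum A k' < m]) else 0.

(* golden_sieve W0 n is the sequence W_n: from X = W_n' to W_(n'.+1) the pointer
   is h = X(n'.+1), and the value d = X(h) is removed. *)
Fixpoint golden_sieve (W0 : nat -> nat) (n : nat) : nat -> nat :=
  if n is n'.+1 then
    let X := golden_sieve W0 n' in
    let h := X n'.+1 in
    let d := X h in
    increasing_enum (terms X `\` [set d])
  else W0.

(* Meaningful for n >= 1, as are deletion, survivor and normalized_survivor. *)
Definition pointer (W0 : nat -> nat) (n : nat) : nat := golden_sieve W0 n.-1 n.

Definition deletion (W0 : nat -> nat) (n : nat) : nat :=
  golden_sieve W0 n.-1 (pointer W0 n).

Definition survivor (W0 : nat -> nat) : nat -> nat :=
  increasing_enum (terms W0 `\` terms (deletion W0)).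

Definition arith_seq (a b : nat) : nat -> nat := fun n => a * n + b.

Definition normalized_survivor (a b n : nat) : rat :=
  (((survivor (arith_seq a b) n)%:R - b%:R) / a%:R)%R.

(* Main.v *)
(** Say that [X] is [a]-spaced if its consecutive terms differ by at least [a].
    Removing a term preserves this, so every [W_n] is [a]-spaced. Since
    [W_n(k) = W_(n-1)(k+1)] for [k >= h_n], and [h_(n+1) > h_n], we get
    [d_(n+1) = W_(n-1)(h_(n+1) + 1)] with [h_(n+1) + 1 >= h_n + 2], hence
    [d_(n+1) >= d_n + 2a]. So two consecutive terms of [aN + b] are never both
    deleted, and a survivor is followed by another one at distance [a] or [2a]. *)
Require Import Defs.
From mathcomp Require Import all_boot all_order all_algebra.
From mathcomp Require Import boolp classical_sets zify.

Set Implicit Arguments.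
Unset Strict Implicit.
Unset Printing Implicit Defensive.

Local Open Scope classical_set_scope.
Local Open Scope nat_scope.

Lemma leastP (A : set nat) (m : nat) : A m ->
  A (least A) /\ forall k, A k -> least A <= k.
Proof.
move=> Am; rewrite /least.
have exA : exists k, `[< A k >] by exists m; apply/asboolP.
case: (ex_minnP exA) => x /asboolP Ax minx.
case: xgetP => [y _ //|/(_ x) []].
by split=> // k Ak; apply/minx/asboolP.
Qed.

(** The witness [x] keeps the set of larger elements of [A] inhabited, so [least] does not fall back
    on its default 0. *)
Lemma increasing_enumS (A : set nat) (k x : nat) :
    A x -> increasing_enum A k < x ->
  [/\ A (increasing_enum A k.+1),
      increasing_enum A k < increasing_enum A k.+1
    & forall y, A y -> increasing_enum A k < y -> increasing_enum A k.+1 <= y].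
Proof.
move=> Ax ltx /=.
have [] := @leastP (A `&` [set m | increasing_enum A k < m]) x; first by split.
by move=> [Al ltl] minl; split=> // y Ay lty; apply: minl.
Qed.

Section Spaced.

Variable a : nat.
Hypothesis a_gt0 : 0 < a.

(** Index 0 is left out because [X 0] is not a term. The condition [0 < X 1] puts every term above
    0, the value from which [increasing_enum] starts. *)
Definition spaced (X : nat -> nat) :=
  0 < X 1 /\ forall k, 0 < k -> X k + a <= X k.+1.

Lemma spaced_add X i m : spaced X -> 0 < i -> X i + m * a <= X (i + m).
Proof.
move=> [_ Xs] i_gt0; elim: m => [|m IHm]; first by rewrite addn0 addn0.
by have := Xs (i + m) (ltn_addr _ i_gt0); rewrite addnS mulSn; lia.
Qed.

Lemma spaced_leq X i j : spaced X -> 0 < i -> i <= j -> X i <= X j.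
Proof.
move=> Xs i_gt0 /subnKC<-.
exact: leq_trans (leq_addr _ _) (spaced_add _ Xs i_gt0).
Qed.

Lemma spaced_ltn X i j : spaced X -> 0 < i -> i < j -> X i < X j.
Proof.
move=> Xs i_gt0 lt_ij.
by have := spaced_leq Xs (ltn0Sn i) lt_ij; have := Xs.2 i i_gt0; lia.
Qed.

(** Applied to the pointers, this shows that they are positive, hence indices of genuine terms. *)
Lemma spaced_geq_id X i : spaced X -> 0 < i -> i <= X i.
Proof.
move=> Xs; case: i => // i _; have := spaced_add i Xs (ltn0Sn 0).
by have := Xs.1; rewrite add1n; nia.
Qed.

Lemma increasing_enum_terms X k : spaced X -> 0 < k ->
  increasing_enum (terms X) k = X k.
Proof.
move=> Xs; case: k => // k _; elim: k => [|k IHk].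
  have [//|[i i_gt0 <-] _ min1] := @increasing_enumS (terms X) 0 (X 1) _ Xs.1.
    by exists 1.
  apply/eqP; rewrite eqn_leq (spaced_leq Xs (ltn0Sn 0) i_gt0) andbT.
  by apply: min1; [exists 1|exact: Xs.1].
have TX : terms X (X k.+2) by exists k.+2.
have lt_X : increasing_enum (terms X) k.+1 < X k.+2.
  by rewrite IHk spaced_ltn.
have [[i i_gt0 Xi] lt_e le_e] := increasing_enumS TX lt_X.
apply/eqP; rewrite eqn_leq le_e // andTb -Xi.
(* An index [i] up to [k.+1] would give a value no larger than the previous enumerated term. *)
apply: spaced_leq => //; rewrite ltnNge; apply/negP => le_i.
by move: lt_e; rewrite IHk -Xi ltnNge spaced_leq.
Qed.

Lemma spaced_bump X h : spaced X -> 0 < h -> spaced (X \o bump h).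
Proof.
move=> Xs h_gt0; split=> [|k k_gt0] /=.
  by apply: leq_trans Xs.1 _; apply: spaced_leq => //; rewrite /bump; lia.
have bk_gt0 : 0 < bump h k by rewrite /bump; lia.
apply: leq_trans (Xs.2 _ bk_gt0) _.
by apply: spaced_leq => //; rewrite /bump; lia.
Qed.

(** Since [bump h] enumerates the indices other than [h], removing a value from the set of terms
    becomes a reindexing; strict monotonicity ensures that the value is not taken at another
    index. *)
Lemma terms_bump X h : spaced X -> 0 < h ->
  terms X `\` [set X h] = terms (X \o bump h).
Proof.
move=> Xs h_gt0; apply/seteqP; split=> x.
  move=> [[k /= k_gt0 <-] neq]; exists (unbump h k) => /=.
    by rewrite /unbump; lia.
  by rewrite unbumpK // inE; apply/eqP => kh; apply: neq; rewrite kh.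
move=> [k /= k_gt0 <-]; split.
  by exists (bump h k) => //=; rewrite /bump; lia.
have := neq_bump h k; rewrite neq_ltn /= => /orP[] lt eqX.
  by have := spaced_ltn Xs h_gt0 lt; rewrite eqX ltnn.
have bk_gt0 : 0 < bump h k by rewrite /bump; lia.
by have := spaced_ltn Xs bk_gt0 lt; rewrite eqX ltnn.
Qed.

(** Needed because a sieved sequence and its reindexed form may differ at the junk index 0. *)
Lemma spaced_eq X Y : (forall k, 0 < k -> X k = Y k) -> spaced X -> spaced Y.
Proof.
by move=> eqXY [X1 Xs]; split=> [|k k_gt0]; rewrite -!eqXY //; exact: Xs.
Qed.

Variable W : nat -> nat.
Hypothesis W_spaced : spaced W.

Lemma golden_sieveS n k : spaced (golden_sieve W n) -> 0 < k ->
  golden_sieve W n.+1 k = golden_sieve W n (bump (pointer W n.+1) k).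
Proof.
move=> Xs k_gt0; have h_gt0 : 0 < pointer W n.+1.
  by apply: leq_trans (spaced_geq_id Xs (ltn0Sn n)).
by rewrite /= terms_bump // increasing_enum_terms //; exact: spaced_bump.
Qed.

Lemma golden_sieve_spaced n : spaced (golden_sieve W n).
Proof.
elim: n => // n Xs; apply: (@spaced_eq (golden_sieve W n \o bump (pointer W n.+1))).
  by move=> k k_gt0; rewrite golden_sieveS.
apply: spaced_bump => //.
by apply: leq_trans (spaced_geq_id Xs (ltn0Sn n)).
Qed.

Lemma pointer_gt0 n : 0 < pointer W n.+1.
Proof. exact: leq_trans (spaced_geq_id (golden_sieve_spaced n) (ltn0Sn n)). Qed.

Lemma pointer_ltn n : pointer W n.+1 < pointer W n.+2.
Proof.
have Xs := golden_sieve_spaced n.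
rewrite [X in _ < X]/pointer [_.+2.-1]/= golden_sieveS //.
(* Both pointers are now terms of the same W_n, at index [n.+1] and at an index at least [n.+2]. *)
by apply: (spaced_ltn Xs); rewrite // /bump; lia.
Qed.

Lemma deletionS n : deletion W n.+1 + 2 * a <= deletion W n.+2.
Proof.
have Xs := golden_sieve_spaced n; have lt_h := pointer_ltn n.
rewrite [X in _ <= X]/deletion [_.+2.-1]/= golden_sieveS ?pointer_gt0 //.
apply: leq_trans (spaced_add 2 Xs (pointer_gt0 n)) _.
by apply: spaced_leq; rewrite // /bump; lia.
Qed.

Lemma deletion_gap i j : 0 < i -> i < j -> deletion W i + 2 * a <= deletion W j.
Proof.
case: i j => // i [] // j _; rewrite ltnS; elim: j => // j IHj.
rewrite leq_eqVlt ltnS => /orP[/eqP[<-]|le_ij]; first exact: deletionS.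
have [->|ne_ij] := eqVneq i j; first exact: deletionS.
by have := IHj ltac:(lia); have := deletionS j; lia.
Qed.

Lemma not_both_deleted x :
  terms (deletion W) x -> ~ terms (deletion W) (x + a).
Proof.
move=> [i i_gt0 <-] [j j_gt0].
have [lt_ij|lt_ji|->] := ltngtP i j; last by lia.
  by have := deletion_gap i_gt0 lt_ij; lia.
by have := deletion_gap j_gt0 lt_ji; lia.
Qed.

End Spaced.

Lemma arith_seq_spaced (a b : nat) : 0 < a -> spaced a (arith_seq a b).
Proof. by move=> a_gt0; rewrite /spaced /arith_seq; split=> [|k _]; lia. Qed.

Lemma survivor_next (a b k : nat) : 0 < a ->
  exists2 j, k < j <= k.+2 &
    (terms (arith_seq a b) `\` terms (deletion (arith_seq a b)))
      (arith_seq a b j).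
Proof.
move=> a_gt0; have Ws := arith_seq_spaced b a_gt0.
have [del|ndel] := pselect (terms (deletion (arith_seq a b)) (arith_seq a b k.+1)).
  exists k.+2; first by lia.
  split; first by exists k.+2.
  suff -> : arith_seq a b k.+2 = arith_seq a b k.+1 + a.
    exact: (not_both_deleted a_gt0 Ws).
  by rewrite /arith_seq; lia.
by exists k.+1; [lia|split=> //; exists k.+1].
Qed.

Lemma survivorS (a b n : nat) : 0 < a ->
  exists k j, [/\ survivor (arith_seq a b) n.+1 = arith_seq a b k,
    survivor (arith_seq a b) n.+2 = arith_seq a b j & k < j <= k.+2].
Proof.
move=> a_gt0; set W := arith_seq a b; set s := survivor W.
have ltW i j : (W i < W j) = (i < j).
  by rewrite /W /arith_seq ltn_add2r ltn_pmul2l.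
(* The value [s n] serves here as an index: as [W i >= i > s n], some surviving term lies beyond
   [s n]. This also covers [n = 0], where [s 0 = 0]. *)
have [i /andP[lt_i _] Ai] := survivor_next b (s n) a_gt0.
have lt_sn : s n < W i by rewrite /W /arith_seq; nia.
have [[[k _ eq_k] _] _ _] := increasing_enumS Ai lt_sn.
have [j /andP[lt_kj le_jk] Aj] := survivor_next b k a_gt0.
have lt_s : s n.+1 < W j by rewrite -[s _]eq_k ltW.
have [[[l _ eq_l] _] lt_l /(_ _ Aj lt_s) le_l] := increasing_enumS Aj lt_s.
exists k, l; split=> //.
move: lt_l le_l; rewrite -eq_l -eq_k ltW => -> /=.
by rewrite leqNgt ltW -leqNgt => /leq_trans; apply.
Qed.

Theorem proposition3p6 (a b : nat) (ha : (2 <= a)%N) (hb : (b < a)%N)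
  (n : nat) (hn : (2 <= n)%N) :
  (normalized_survivor a b n - normalized_survivor a b n.-1 = 1)%R \/
  (normalized_survivor a b n - normalized_survivor a b n.-1 = 2)%R.
Proof.
case: n hn => [|[|n]] // _; have a_gt0 := ltnW ha.
have a_neq0 : (a%:R != 0 :> rat)%R by rewrite Num.Theory.pnatr_eq0 -lt0n.
(* Normalizing recovers the index of a survivor in the progression, so the gap is a difference of
   indices. *)
have normE m k : survivor (arith_seq a b) m = arith_seq a b k ->
    normalized_survivor a b m = (k%:R)%R.
  rewrite /normalized_survivor => ->; rewrite /arith_seq GRing.natrD GRing.natrM.
  by rewrite GRing.addrK GRing.mulrC GRing.mulKf.
have [k [j [/normE/= -> /normE -> /andP[lt_kj le_jk]]]] := survivorS b n a_gt0.
rewrite -GRing.natrB 1?ltnW //.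
have [->|->] : j - k = 1 \/ j - k = 2 by lia.
  by left.
by right.
Qed.
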